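(* For each integer $n\geq 10$, the prime difference graph $G_n$ contains a Hamilton cycle all of whose edges $uv$ satisfy $|u-v|\in\{2,3\}$.
   Context: For a positive integer $n$, the prime difference graph $G_n$ of order $n$ is the graph with vertex set $\{1,2,\dots,n\}$ in which two vertices $u,v$ are adjacent if and only if $|u-v|$ is a prime number. A Hamilton cycle is a cycle visiting each vertex of the graph exactly once. *)

(* Defs.v *)
From mathcomp Require Import all_boot all_order all_algebra.

Set Implicit Arguments.
Unset Strict Implicit.
Unset Printing Implicit Defensive.

(* The vertex set {1, ..., n} is carried by 'I_n; the ordinal i is the vertex
   i + 1. *)
Definition label (n : nat) (u : 'I_n) : nat := u.+1.

(* The absolute difference `|_ - _| is taken in int (see IntDist), so nothing
   is truncated. *)
Definition vdist (n : nat) (u v : 'I_n) : nat := `|label u - label v|%N.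

Definition prime_difference_graph (n : nat) : rel 'I_n :=
  fun u v => prime (vdist u v).

Lemma vdistC (n : nat) (u v : 'I_n) : vdist u v = vdist v u.
Proof. exact: IntDist.distnC. Qed.

Lemma prime_difference_graph_sym (n : nat) :
  symmetric (@prime_difference_graph n).
Proof. by move=> u v; rewrite /prime_difference_graph vdistC. Qed.

Lemma prime_difference_graph_irrefl (n : nat) :
  irreflexive (@prime_difference_graph n).
Proof. by move=> u; rewrite /prime_difference_graph /vdist IntDist.distnn. Qed.

(* [cycle] also accepts closed walks of length at most 2, which are not cycles
   of a simple graph; hence the condition on the size. *)
Definition hamilton_cycle (T : finType) (e : rel T) (c : seq T) : Prop :=
  [/\ 2 < size c, cycle e c, uniq c & forall x : T, x \in c].

Definition cycle_edge (T : eqType) (c : seq T) (u v : T) : bool :=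
  [&& u \in c, v \in c & (v == next c u) || (u == next c v)].

(* Main.v *)
Require Import Defs.
From mathcomp Require Import all_boot all_order all_algebra.
From mathcomp Require Import zify.

(** A Hamilton cycle of this kind is forced near the low end: it must run
    through 5, 2, 0, 3, 1, 4 (vertices numbered from 0).  What remains above is
    a Hamilton path from 4 to 5 on the vertices 4, ..., n - 1, that is, after a
    shift, a Hamilton path from 0 to 1 on 0, ..., m - 1 with m = n - 4 and all
    steps of length 2 or 3.  Conversely each such path closes up to a Hamilton
    cycle ([hamilton_cycle_of_path]).

    Paths of this kind grow by five vertices at a time ([low_path_extend]):
    shift one up by 5, so that it joins 5 to 6, and attach its ends to 0 and 1
    by the strands 0, 3, 6 and 1, 4, 2, 5, which use up 0, ..., 4.  As there
    are paths for m = 6, ..., 10, there is one for every m >= 6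
    ([low_path_exists]), and hence a cycle for every n >= 10. *)

Definition step23 : rel nat :=
  fun a b => [|| a == b + 2, b == a + 2, a == b + 3 | b == a + 3].

(** The list holds only the interior vertices, so that both ends stay visible
    when the path is reversed. *)
Definition low_path (m : nat) (q : seq nat) : bool :=
  sorted step23 (0 :: rcons q 1) && perm_eq (0 :: rcons q 1) (iota 0 m).

Lemma step23_sym : symmetric step23.
Proof. by move=> a b; rewrite /step23; lia. Qed.

Lemma sorted_step23_shift k s :
  sorted step23 (map (addn k) s) = sorted step23 s.
Proof.
rewrite sorted_map; apply: eq_sorted => a b /=.
by rewrite /step23; lia.
Qed.

Lemma perm_iota_shift k m s :
  perm_eq s (iota 0 m) -> perm_eq (map (addn k) s) (iota k m).
Proof. by move=> s_iota; rewrite -[k in iota k]addn0 iotaDl perm_map. Qed.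

(** The junctions 3, 6 and 5, 2 are legal steps because the shifted path ends
    at 5 and 6; it is reversed so that 0 stays the first vertex. *)
Lemma low_path_extend m q : low_path m q ->
  low_path (5 + m)
    (3 :: rev (map (addn 5) (0 :: rcons q 1)) ++ [:: 2; 4]).
Proof.
case/andP=> q_path q_perm; apply/andP; split; last first.
  move/(@perm_iota_shift 5): q_perm => /permP q_count.
  set s := map _ _ in q_count *.
  rewrite iotaD; apply/permP => a; rewrite count_cat -q_count.
  rewrite -cats1 /= -catA !count_cat count_rev /=.
  by lia.
have : sorted step23 (rev (map (addn 5) (0 :: rcons q 1))).
  rewrite rev_sorted (eq_sorted (e' := step23)) ?sorted_step23_shift //.
  by move=> a b; rewrite step23_sym.
rewrite /= map_rcons rev_cons rev_rcons /= => rev_path.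
by rewrite -cats1 -catA cat_path rev_path last_rcons.
Qed.

Lemma low_path_exists m : 6 <= m -> exists q, low_path m q.
Proof.
elim/ltn_ind: m => m IH m_ge6.
have [m_ge11 | m_lt11] := leqP 11 m.
  have [||q /low_path_extend q_path] := IH (m - 5); [lia | lia |].
  by rewrite subnKC in q_path; [eexists; exact: q_path | lia].
have : m \in iota 6 5 by rewrite mem_iota; lia.
(* Induction by steps of five needs five starting lengths. *)
rewrite !inE => /or4P[/eqP->|/eqP->|/eqP->|/orP[]/eqP->].
- by exists [:: 3; 5; 2; 4].
- by exists [:: 2; 5; 3; 6; 4].
- by exists [:: 2; 5; 7; 4; 6; 3].
- by exists [:: 2; 4; 7; 5; 8; 6; 3].
- by exists [:: 2; 4; 7; 9; 6; 8; 5; 3].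
Qed.

(** Shifting by 4 makes room for the forced strand 5, 2, 0, 3, 1, 4, which
    joins the two ends of the shifted path. *)
Lemma hamilton_cycle_of_path m q : low_path m q ->
  let c := map (addn 4) (0 :: rcons q 1) ++ [:: 2; 0; 3; 1] in
  cycle step23 c /\ perm_eq c (iota 0 (4 + m)).
Proof.
case/andP=> q_path q_perm c; rewrite {}/c; split; last first.
  move/(@perm_iota_shift 4): q_perm => /permP q_count.
  set s := map _ _ in q_count *.
  rewrite iotaD; apply/permP => a; rewrite !count_cat -q_count /=.
  by lia.
move: q_path; rewrite -(sorted_step23_shift 4) /= map_rcons => q_path.
by rewrite -cats1 -catA cat_path q_path last_rcons.
Qed.

Lemma step23_vdist n (u v : 'I_n) :
  step23 u v -> vdist u v = 2 \/ vdist u v = 3.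
Proof. by rewrite /step23 /vdist /label; lia. Qed.

Lemma lift_to_ord n (s : seq nat) :
  perm_eq s (iota 0 n) -> exists c : seq 'I_n, map val c = s.
Proof.
move=> s_iota; exists (pmap insub s).
rewrite pmap_filter; last exact: insubK.
apply/all_filterP/allP => i; rewrite (perm_mem s_iota) mem_iota => i_lt.
by rewrite isSome_insub.
Qed.

Theorem proposition4p2 (n : nat) (hn : 10 <= n) :
  exists c : seq 'I_n,
    hamilton_cycle (@prime_difference_graph n) c /\
    (forall u v : 'I_n, cycle_edge c u v -> vdist u v = 2 \/ vdist u v = 3).
Proof.
have [|q /hamilton_cycle_of_path[]] := @low_path_exists (n - 4); first lia.
rewrite subnKC; last lia.
set s := _ ++ _ => s_cycle s_perm.
have [c c_s] := @lift_to_ord n s s_perm.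
have c_cycle : cycle (relpre val step23) c by rewrite -cycle_map c_s.
exists c; split; last first.
  move=> u v /and3P[u_c v_c /orP[]/eqP->]; last rewrite vdistC.
    by apply: step23_vdist; exact: (next_cycle c_cycle).
  by apply: step23_vdist; exact: (next_cycle c_cycle).
split.
- by rewrite -(size_map val) c_s (perm_size s_perm) size_iota; lia.
- apply: sub_cycle c_cycle => u v /step23_vdist.
  by rewrite /prime_difference_graph => -[] ->.
- by rewrite -(map_inj_uniq val_inj) c_s (perm_uniq s_perm) iota_uniq.
- move=> x; rewrite -(mem_map val_inj) c_s (perm_mem s_perm) mem_iota.
  exact: ltn_ord.
Qed.
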